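(* Let $f:\mathbb{R}^n\to\mathbb{R}$ be a convex function. The following conditions are equivalent: (1) $f$ cannot be uniformly approximated by strictly convex functions. (2) $f$ cannot be uniformly approximated by strongly convex functions. (3) There exist $k<n$, a linear projection $P:\mathbb{R}^n\to\mathbb{R}^k$, a convex function $c:\mathbb{R}^k\to\mathbb{R}$ and a linear function $\ell:\mathbb{R}^n\to\mathbb{R}$ such that $f=c\circ P+\ell$.
   Context: ''$f$ can be uniformly approximated by functions in a class'' means: for every $\varepsilon>0$ there is $g:\mathbb{R}^n\to\mathbb{R}$ in the class with $|f-g|\leq\varepsilon$ on all of $\mathbb{R}^n$. In (3), $k\ge 0$ is an integer (with $\mathbb{R}^0=\{0\}$) and a linear projection $\mathbb{R}^n\to\mathbb{R}^k$ is a surjective linear map. Strictly convex: $g((1-t)x+ty)<(1-t)g(x)+tg(y)$ for $x\neq y$, $0<t<1$. Strongly convex: a $C^2$ function $\varphi$ is strongly convex if its second derivative along every (nonconstant) line is strictly positive everywhere on its domain. A not necessarily smooth function $g$ is strongly convex if for every point $p$ of its domain and every $C^\infty$ strongly convex function $\varphi$ defined on a neighborhood of $p$ there is $\delta>0$ such that $g-\delta\varphi$ is convex on some neighborhood of $p$. *)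

(* Defs.v *)
From HB Require Import structures.
From mathcomp Require Import all_boot all_order all_algebra.
From mathcomp Require Import all_classical all_reals all_analysis.

Set Implicit Arguments.
Unset Strict Implicit.
Unset Printing Implicit Defensive.

Import Order.TTheory GRing.Theory Num.Theory.
Import numFieldNormedType.Exports.

Local Open Scope classical_set_scope.
Local Open Scope ring_scope.

(* A function "defined on the open set U" is encoded as a total function of
   which only the restriction to U is constrained: for U open, continuity and
   derivatives at the points of U only depend on that restriction. *)

(* For U open, phi is of class C^k on U: all iterated partial derivatives of
   order at most k exist and are continuous on U. *)
Fixpoint Ck_on (R : realType) (n k : nat) (U : set 'rV[R]_n)
    (phi : 'rV[R]_n -> R) {struct k} : Prop :=
  (forall x, U x -> {for x, continuous phi}) /\
  if k is k'.+1 then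
    forall i : 'I_n,
      (forall x, U x -> derivable phi x (delta_mx 0 i)) /\
      Ck_on k' U ('D_(delta_mx 0 i) phi)
  else True.

Definition smooth_on (R : realType) (n : nat) (U : set 'rV[R]_n)
    (phi : 'rV[R]_n -> R) : Prop :=
  forall k, Ck_on k U phi.

(* Strong convexity of a C^2 function on an open set; U need not be convex. *)
Definition strongly_convex_C2_on (R : realType) (n : nat) (U : set 'rV[R]_n)
    (phi : 'rV[R]_n -> R) : Prop :=
  Ck_on 2 U phi /\
  forall (x v : 'rV[R]_n) (t : R), v != 0 -> U (x + t *: v) ->
    0 < derive1n 2 (fun s : R => phi (x + s *: v)) t.

(* The library's [convex_function] does not require its domain to be convex,
   hence the separate [convex_set]. *)
Definition strongly_convex (R : realType) (n : nat) (g : 'rV[R]_n -> R) :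
    Prop :=
  forall (p : 'rV[R]_n) (U : set 'rV[R]_n) (phi : 'rV[R]_n -> R),
    open U -> U p -> smooth_on U phi -> strongly_convex_C2_on U phi ->
    exists2 delta : R, 0 < delta &
      exists V : set 'rV[R]_n,
        [/\ nbhs p V, V `<=` U, convex_set (M := 'rV[R]_n) V &
            convex_function (E := 'rV[R]_n) V
              (fun x => g x - delta * phi x)].

Definition strictly_convex (R : realType) (n : nat) (g : 'rV[R]_n -> R) :
    Prop :=
  forall (x y : 'rV[R]_n) (t : R), x != y -> 0 < t -> t < 1 ->
    g ((1 - t) *: x + t *: y) < (1 - t) * g x + t * g y.

Definition uniformly_approximable (R : realType) (n : nat)
    (C : set ('rV[R]_n -> R)) (f : 'rV[R]_n -> R) : Prop :=
  forall eps : R, 0 < eps ->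
    exists2 g : 'rV[R]_n -> R, C g & forall x, `|f x - g x| <= eps.

(* Main.v *)
Require Import Defs.
From HB Require Import structures.
From mathcomp Require Import all_boot all_order all_algebra.
From mathcomp Require Import all_classical all_reals all_analysis.
From mathcomp Require Import ring lra.

Set Implicit Arguments.
Unset Strict Implicit.
Unset Printing Implicit Defensive.

Import Order.TTheory GRing.Theory Num.Theory.
Import numFieldNormedType.Exports.

Local Open Scope classical_set_scope.
Local Open Scope ring_scope.

(* Locally, a strongly convex function is the sum of a convex function and of a
   positive multiple of |x|^2, hence it is strictly convex along every segment;
   and if f is affine along a line, a strictly convex function close to f would
   be, up to an affine function, bounded and strictly convex on that line. So
   everything reduces to approximating, by strongly convex functions, a convex f
   that is affine along no line. The slopes of the affine minorants of such an f
   affinely span the dual space (if they all agreed on some v, subgradients would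
   make f affine along v), so averaging smoothed maxima of affine minorants gives
   a strongly convex w <= f. Then g = f + eps / (1 + f - w) is within eps of f,
   and it is strongly convex: linearising u |-> eps / (1 + u) at a point bounds g
   from below by a convex combination of f and w, up to a constant, in which the
   weight of w is locally bounded away from 0. *)

(** * Moduli of convexity *)

Section Modulus.
Variables (R : realType) (n : nat).
Implicit Types (x y z v : 'rV[R]_n) (f g : 'rV[R]_n -> R) (D : set 'rV[R]_n).

(** The Euclidean norm squared, whereas [ball] refers to the sup norm. *)
Definition sqnorm v : R := \sum_i v 0 i ^+ 2.

(* Negative values of m are used as well: they express semiconvexity. *)
Definition convex_modulus (m : R) D g :=
  forall x y t, D x -> D y -> 0 <= t -> t <= 1 ->
    g ((1 - t) *: x + t *: y) + m * (t * (1 - t)) * sqnorm (x - y) <=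
    (1 - t) * g x + t * g y.

Lemma sqnorm_ge0 v : 0 <= sqnorm v.
Proof. by apply: sumr_ge0 => i _; rewrite sqr_ge0. Qed.

Lemma sqnormZ (a : R) v : sqnorm (a *: v) = a ^+ 2 * sqnorm v.
Proof.
by rewrite /sqnorm mulr_sumr; apply: eq_bigr => i _; rewrite mxE exprMn.
Qed.

Lemma sqnorm_gt0 v : v != 0 -> 0 < sqnorm v.
Proof.
move=> v0; rewrite lt_neqAle sqnorm_ge0 andbT eq_sym; apply: contra v0.
rewrite psumr_eq0 => [/allP h|i _]; last by rewrite sqr_ge0.
apply/eqP/rowP => i; rewrite mxE; apply/eqP; rewrite -sqrf_eq0.
by apply: h; rewrite mem_index_enum.
Qed.

Lemma convex_set_combine D x y t : convex_set (M := 'rV[R]_n) D ->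
  D x -> D y -> 0 <= t -> t <= 1 -> D ((1 - t) *: x + t *: y).
Proof.
move=> cD Dx Dy t0 t1.
have t01 : 0 <= 1 - t <= 1 by apply/andP; split; lra.
have := cD x y (Itv01 (andP t01).1 (andP t01).2).
rewrite !inE => /(_ Dx Dy).
by rewrite /conv /= /unstable.onem /= opprB addrCA subrr addr0.
Qed.

Lemma convex_function_modulus D g :
  convex_function (E := 'rV[R]_n) D g <-> convex_modulus 0 D g.
Proof.
split=> [cg x y t Dx Dy t0 t1|cg t x y].
  have t01 : 0 <= 1 - t <= 1 by apply/andP; split; lra.
  have := cg (Itv01 (andP t01).1 (andP t01).2) x y.
  rewrite !inE => /(_ Dx Dy).
  rewrite /conv /= /conv /= /unstable.onem /= opprB addrCA subrr addr0.
  by rewrite !mul0r addr0.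
rewrite !inE => Dx Dy.
have h0 : 0 <= t%:num by [].
have h1 : t%:num <= 1 by [].
have := cg x y (1 - t%:num) Dx Dy.
rewrite !mul0r addr0 opprB addrCA subrr addr0; apply; lra.
Qed.

Lemma sub_convex_modulus m D D' g :
  D `<=` D' -> convex_modulus m D' g -> convex_modulus m D g.
Proof. by move=> DD' cg x y t /DD' + /DD'; exact: cg. Qed.

Lemma convex_modulusD m1 m2 D g1 g2 : convex_modulus m1 D g1 ->
  convex_modulus m2 D g2 -> convex_modulus (m1 + m2) D (fun x => g1 x + g2 x).
Proof.
move=> c1 c2 x y t Dx Dy t0 t1.
have := lerD (c1 x y t Dx Dy t0 t1) (c2 x y t Dx Dy t0 t1); lra.
Qed.

Lemma convex_modulusZ m (a : R) D g : 0 <= a ->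
  convex_modulus m D g -> convex_modulus (a * m) D (fun x => a * g x).
Proof.
move=> a0 c x y t Dx Dy t0 t1.
have := ler_wpM2l a0 (c x y t Dx Dy t0 t1); lra.
Qed.

(** The tangent at [z = (1 - t) x + t y] is evaluated at [x] and at [y]; in the weighted mean the
    linear terms cancel, and the squares add up to [t (1 - t) |x - y|^2]. *)
Lemma tangent_convex_modulus m D g : convex_set (M := 'rV[R]_n) D ->
  (forall z, D z -> exists p : 'cV[R]_n, forall y, D y ->
     g z + ((y - z) *m p) 0 0 + m * sqnorm (y - z) <= g y) ->
  convex_modulus m D g.
Proof.
move=> cD tg x y t Dx Dy t0 t1; set z := _ *: _ + _.
have [p hp] := tg z (convex_set_combine cD Dx Dy t0 t1).
have zx : x - z = t *: (x - y).
  by rewrite /z; apply/rowP => i; rewrite !mxE; ring.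
have zy : y - z = (t - 1) *: (x - y).
  by rewrite /z; apply/rowP => i; rewrite !mxE; ring.
have := hp x Dx; have := hp y Dy; rewrite zx zy !sqnormZ -!scalemxAl !mxE.
set P := \sum_(_ < _) _; set S := sqnorm _ => h1 h2.
have t1' : 0 <= 1 - t by lra.
have := lerD (ler_wpM2l t0 h1) (ler_wpM2l t1' h2); lra.
Qed.

End Modulus.

(** * Subgradients and slopes of affine minorants *)

Section Subgradient.
Variables (R : realType) (n : nat).
Implicit Types (x y z v : 'rV[R]_n) (p q : 'cV[R]_n) (f : 'rV[R]_n -> R).

Definition dot x p : R := (x *m p) 0 0.

Lemma dotE x p : dot x p = \sum_i x 0 i * p i 0.
Proof. by rewrite /dot mxE. Qed.

Lemma dotDl x y p : dot (x + y) p = dot x p + dot y p.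
Proof. by rewrite /dot mulmxDl mxE. Qed.

Lemma dotZl (a : R) x p : dot (a *: x) p = a * dot x p.
Proof. by rewrite /dot -scalemxAl mxE. Qed.

Lemma dotNl x p : dot (- x) p = - dot x p.
Proof. by rewrite /dot mulNmx mxE. Qed.

Lemma dotDr x p q : dot x (p + q) = dot x p + dot x q.
Proof. by rewrite /dot mulmxDr mxE. Qed.

Lemma dotNr x p : dot x (- p) = - dot x p.
Proof. by rewrite /dot mulmxN mxE. Qed.

Lemma dotZr (a : R) x p : dot x (a *: p) = a * dot x p.
Proof. by rewrite /dot -scalemxAr mxE. Qed.

(** Convexity with unnormalised weights, the form in which two half-lines are compared below. *)
Lemma convex_modulus0_pos f x y (s t : R) : convex_modulus 0 setT f ->
  0 < s -> 0 < t ->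
  (s + t) * f ((s + t)^-1 *: (s *: x + t *: y)) <= s * f x + t * f y.
Proof.
move=> cf s0 t0; have st0 : 0 < s + t by rewrite addr_gt0.
have st1 : s + t != 0 by rewrite gt_eqF.
have := cf x y (t / (s + t)) I I.
rewrite ler_pdivrMr// mul1r lerDr (ltW s0) !mul0r addr0.
rewrite (divr_ge0 (ltW t0) (ltW st0)) => /(_ isT isT).
have -> : 1 - t / (s + t) = s / (s + t) by field.
rewrite scalerDr !scalerA ![(s + t)^-1 * _]mulrC => h.
rewrite -ler_pdivlMl//; apply: le_trans h _.
by rewrite mulrDr !mulrA ![_^-1 * _]mulrC.
Qed.

(* Hahn-Banach, one coordinate at a time: the bounds imposed on the next
   coordinate q of the subgradient by the two half-lines are compatible. *)
Lemma subgradient_step f (k : nat) p : convex_modulus 0 setT f -> f 0 = 0 ->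
  (forall y, (forall i : 'I_n, (k <= i)%N -> y 0 i = 0) -> dot y p <= f y) ->
  exists p', forall y, (forall i : 'I_n, (k < i)%N -> y 0 i = 0) ->
    dot y p' <= f y.
Proof.
move=> cf f0 hp; case: (ltnP k n) => [kn|nk]; last first.
  by exists p => y hy; apply: hp => i /(leq_trans nk); rewrite leqNgt ltn_ord.
pose j := Ordinal kn; pose e : 'rV[R]_n := delta_mx 0 j.
pose low y := forall i : 'I_n, (k <= i)%N -> y 0 i = 0.
(* With weights [t] and [s] the multiples of [e] cancel, so the hypothesis on [p] applies to the
   combined point. *)
have key y y' s t : low y -> low y' -> 0 < s -> 0 < t ->
    t * (dot y p - f (y - s *: e)) <= s * (f (y' + t *: e) - dot y' p).
  move=> ly ly' s0 t0.
  have st0 : 0 < s + t by rewrite addr_gt0.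
  have := convex_modulus0_pos (y - s *: e) (y' + t *: e) cf t0 s0.
  have -> : t *: (y - s *: e) + s *: (y' + t *: e) = t *: y + s *: y'.
    by apply/rowP => i; rewrite !mxE; ring.
  have lz : low ((t + s)^-1 *: (t *: y + s *: y')).
    by move=> i ki; rewrite !mxE ly// ly'// !mulr0 addr0 mulr0.
  have := ler_wpM2l (ltW st0) (hp _ lz).
  rewrite dotZl dotDl !dotZl addrC mulVKf ?gt_eqF//; lra.
(* Lower bounds for the new coordinate, given by the half-lines towards [- e]; the half-lines
   towards [e] give upper bounds of [A], so [sup A] satisfies both. *)
pose A := [set r : R | exists y s,
  [/\ low y, 0 < s & r = (dot y p - f (y - s *: e)) / s]].
have l0 : low 0 by move=> i _; rewrite mxE.
have Aub y t : low y -> 0 < t -> ubound A ((f (y + t *: e) - dot y p) / t).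
  move=> ly t0 _ [y' [s [ly' s0 ->]]].
  by rewrite ler_pdivrMr// mulrAC ler_pdivlMr// mulrC [leRHS]mulrC; exact: key.
have hA : has_sup A.
  split; first by exists ((dot 0 p - f (0 - 1 *: e)) / 1), 0, 1.
  by exists ((f (0 + 1 *: e) - dot 0 p) / 1); apply: Aub.
exists (\col_i (if i == j then sup A else p i 0)) => y hy.
set p' := \col_i _.
pose y0 := y - y 0 j *: e.
have ly0 : low y0.
  move=> i; rewrite leq_eqVlt => /predU1P[ki|ki].
    have -> : i = j by apply/val_inj.
    by rewrite !mxE !eqxx mulr1 subrr.
  have ij : i == j = false by apply/negP => /eqP ij; rewrite ij ltnn in ki.
  by rewrite !mxE (hy i)// ij andbF mulr0 subr0.
have yE : y = y0 + y 0 j *: e by rewrite /y0 subrK.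
have dp' : dot y p' = dot y0 p + y 0 j * sup A.
  rewrite [in LHS]yE dotDl dotZl; congr (_ + _ * _); last first.
    rewrite dotE (bigD1 j)//= big1 ?addr0 => [|i ij].
      by rewrite !mxE !eqxx mul1r.
    by rewrite !mxE (negbTE ij) andbF mul0r.
  rewrite !dotE; apply: eq_bigr => i _.
  by rewrite [p' i 0]mxE; case: (i =P j) => // ->; rewrite ly0// !mul0r.
rewrite dp'; case: (ltrgtP (y 0 j) 0) => yj.
- have ny : 0 < - y 0 j by rewrite oppr_gt0.
  have : (dot y0 p - f (y0 - (- y 0 j) *: e)) / (- y 0 j) <= sup A.
    by apply: ub_le_sup; [exact: hA.2|exists y0, (- y 0 j)].
  by rewrite scaleNr opprK -yE ler_pdivrMr//; lra.
- have : sup A <= (f (y0 + y 0 j *: e) - dot y0 p) / (y 0 j).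
    by apply: ge_sup; [exact: hA.1|exact: Aub].
  by rewrite -yE ler_pdivlMr//; lra.
- by move: (hp _ ly0); rewrite [in f y]yE yj scale0r addr0 mul0r addr0.
Qed.

(** After translating to [x = 0] and [f x = 0], the extension step is iterated from the zero
    subspace, with [k = 0], to the whole space, with [k = n]. *)
Lemma subgradient_exists f x : convex_modulus 0 setT f ->
  exists p, forall y, f x + dot (y - x) p <= f y.
Proof.
move=> cf; pose g y := f (x + y) - f x.
have cg : convex_modulus 0 setT g.
  move=> y z t _ _ t0 t1; rewrite /g !mul0r addr0.
  have := cf (x + y) (x + z) t I I t0 t1; rewrite !mul0r addr0.
  have -> : (1 - t) *: (x + y) + t *: (x + z) = x + ((1 - t) *: y + t *: z).
    by apply/rowP => i; rewrite !mxE; ring.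
  lra.
have g0 : g 0 = 0 by rewrite /g addr0 subrr.
have sub k : exists p, forall y,
    (forall i : 'I_n, (k <= i)%N -> y 0 i = 0) -> dot y p <= g y.
  elim: k => [|k [p hp]]; last exact: subgradient_step hp.
  exists 0 => y hy; have -> : y = 0 by apply/rowP => i; rewrite hy// mxE.
  by rewrite g0 /dot mulmx0 mxE.
have [p hp] := sub n; exists p => y; have := hp (y - x).
rewrite /g [x + _]addrC subrK => hy.
have /hy : forall i : 'I_n, (n <= i)%N -> (y - x) 0 i = 0.
  by move=> i; rewrite leqNgt ltn_ord.
lra.
Qed.

(** Equivalently, [p] lies in the effective domain of the convex conjugate of [f]. *)
Definition slope f p := exists b : R, forall y, dot y p - b <= f y.

(* If all slopes agree on v, the subgradients at x and x + t v give the two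
   inequalities. *)
Lemma slope_const_affine f v (alpha : R) : convex_modulus 0 setT f ->
  (forall p, slope f p -> dot v p = alpha) ->
  forall x t, f (x + t *: v) = f x + alpha * t.
Proof.
move=> cf sl x t.
have sg y : exists2 p, dot v p = alpha & forall z, f y + dot (z - y) p <= f z.
  have [p hp] := subgradient_exists y cf; exists p => //.
  apply: sl; exists (dot y p - f y) => z.
  by have := hp z; rewrite dotDl dotNl; lra.
have [p pv hp] := sg x; have [q qv hq] := sg (x + t *: v).
have := hp (x + t *: v); have := hq x.
rewrite addrAC subrr add0r opprD addrA subrr add0r dotNl !dotZl pv qv.
by move=> h1 h2; apply: le_anti; apply/andP; split; lra.
Qed.

End Subgradient.

(** * Balls of the sup norm and bounds on them *)

Section Balls.
Variables (R : realType) (n : nat).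
Implicit Types (x y z v : 'rV[R]_n) (f : 'rV[R]_n -> R).

Lemma ball_coordP p (r : R) x : 0 < r ->
  ball p r x <-> forall i : 'I_n, `|p 0 i - x 0 i| < r.
Proof.
move=> r0; split=> [[_ bx] i|bx]; first exact: bx.
by split=> // i j; rewrite [i]ord1; exact: bx.
Qed.

Lemma convex_set_ball p (r : R) : convex_set (M := 'rV[R]_n) (ball p r).
Proof.
move=> x y t; rewrite !inE => bx; have r0 : 0 < r by case: bx.
move: bx => /(ball_coordP _ _ r0) px /(ball_coordP _ _ r0) py.
apply/(ball_coordP _ _ r0) => i; rewrite /conv /= /unstable.onem /= !mxE.
have h0 : 0 <= t%:num by [].
have h1 : t%:num <= 1 by [].
have cvx_gt0 (a b : R) : 0 < a -> 0 < b -> 0 < t%:num * a + (1 - t%:num) * b.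
  by move=> a0 b0; case: (lerP a b) => ab; nra.
have := px i; have := py i; rewrite !ltr_norml => /andP[a1 a2] /andP[b1 b2].
have h2 := cvx_gt0 (p 0 i - x 0 i + r) (p 0 i - y 0 i + r).
have h3 := cvx_gt0 (r - (p 0 i - x 0 i)) (r - (p 0 i - y 0 i)).
apply/andP; split.
  by have {}h2 := h2 ltac:(lra) ltac:(lra); lra.
by have {}h3 := h3 ltac:(lra) ltac:(lra); lra.
Qed.

(** A point whose [i]-th offset [c i] is in [[-1, 1]] lies between the points with offsets 1 and -1,
    so by induction the values on a cube are bounded by those at its vertices. *)
Lemma convex_bounded_along f (s : seq 'I_n) : convex_modulus 0 setT f ->
  forall p, exists M : R, forall c : 'I_n -> R, (forall i, `|c i| <= 1) ->
    f (p + \sum_(i <- s) c i *: delta_mx 0 i) <= M.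
Proof.
move=> cf; elim: s => [|i s IHs] p.
  by exists (f p) => c _; rewrite big_nil addr0.
have [M1 hM1] := IHs (p + delta_mx 0 i).
have [M2 hM2] := IHs (p - delta_mx 0 i).
exists (Num.max M1 M2) => c hc; rewrite big_cons.
set S := \sum_(j <- s) _; set M := Num.max _ _.
have h1 : f (p + delta_mx 0 i + S) <= M by rewrite le_max hM1.
have h2 : f (p - delta_mx 0 i + S) <= M by rewrite le_max hM2// orbT.
have := hc i; rewrite ler_norml => /andP[c0 c1].
have := cf (p + delta_mx 0 i + S) (p - delta_mx 0 i + S) ((1 - c i) / 2) I I.
rewrite !mul0r addr0.
have -> : (1 - (1 - c i) / 2) *: (p + delta_mx 0 i + S) +
    (1 - c i) / 2 *: (p - delta_mx 0 i + S) = p + (c i *: delta_mx 0 i + S).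
  by apply/rowP => j; rewrite !mxE; field.
by move=> h; apply: le_trans (h _ _) _; nra.
Qed.

Lemma convex_bounded_ball f p : convex_modulus 0 setT f ->
  exists M : R, forall x, ball p 1 x -> f x <= M.
Proof.
move=> cf; have [M hM] := convex_bounded_along (index_enum 'I_n) cf p.
exists M => x /(ball_coordP _ _ ltr01) px; have := hM (fun i => x 0 i - p 0 i).
have -> : \sum_i (x 0 i - p 0 i) *: delta_mx 0 i = x - p.
  by rewrite [RHS]row_sum_delta; apply: eq_bigr => i _; rewrite !mxE.
by rewrite addrC subrK; apply => i; rewrite distrC ltW.
Qed.

Lemma dot_convex (p : 'cV[R]_n) D : convex_modulus 0 D (fun x => dot x p).
Proof. by move=> x y t _ _ _ _; rewrite dotDl !dotZl !mul0r addr0. Qed.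

Lemma dot_bounded_ball p (q : 'cV[R]_n) :
  exists2 M : R, 0 <= M & forall x, ball p 1 x -> `|dot x q| <= M.
Proof.
have [M1 h1] := convex_bounded_ball p (@dot_convex q setT).
have [M2 h2] := convex_bounded_ball p (@dot_convex (- q) setT).
exists (`|M1| + `|M2|); first by rewrite addr_ge0.
move=> x px; have := h1 x px; have := h2 x px; rewrite dotNr ler_norml.
have := ler_norm M1; have := ler_norm M2.
have := normr_ge0 M1; have := normr_ge0 M2.
by move=> *; apply/andP; split; lra.
Qed.

End Balls.

(** * A strongly convex minorant *)

Section Minorant.
Variables (R : realType).

(** A smooth, locally strongly convex substitute for [|u|]: half of [u + bump u] is a smoothed
    maximum of [u] and 0. *)
Local Notation bump u := (Num.sqrt (1 + u ^+ 2)).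

Lemma bump_sqr (u : R) : bump u ^+ 2 = 1 + u ^+ 2.
Proof. by rewrite sqr_sqrtr// addr_ge0// sqr_ge0. Qed.

Lemma bump_ge1 (u : R) : 1 <= bump u.
Proof. by rewrite -[leLHS]sqrtr1 ler_wsqrtr// lerDl sqr_ge0. Qed.

Lemma bump_le (u : R) : bump u <= 1 + `|u|.
Proof.
have h : 0 <= 1 + `|u| by rewrite addr_ge0.
rewrite -[leRHS](ger0_norm h) -sqrtr_sqr ler_wsqrtr//.
by rewrite -(normr_idP (sqr_ge0 u)) normrX; have := normr_ge0 u; nra.
Qed.

(* The error of the tangent is (u - z)^2 / (s z (s u s z + 1 + u z)) for
   s = bump, because (s u s z)^2 - (1 + u z)^2 = (u - z)^2. *)
Lemma bump_tangent (S u z : R) : bump u <= S -> bump z <= S ->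
  bump z + z / bump z * (u - z) + (u - z) ^+ 2 / (2 * S ^+ 3) <= bump u.
Proof.
have := bump_sqr u; have := bump_sqr z; have := bump_ge1 u; have := bump_ge1 z.
set a := bump z; set b := bump u => a1 b1 a2 b2 bS aS.
have a0 : 0 < a by lra.
have S0 : 0 < S by lra.
have ab : 0 < a * b by rewrite mulr_gt0//; lra.
have e1 : (a * b) ^+ 2 = (1 + u * z) ^+ 2 + (u - z) ^+ 2.
  by rewrite exprMn a2 b2; ring.
have e2 : 1 + u * z <= a * b.
  case: (lerP (1 + u * z) 0) => h; first by lra.
  rewrite -ler_sqr ?nnegrE; [|exact: ltW|exact: ltW].
  by rewrite e1 lerDl sqr_ge0.
have e3 : (u - z) ^+ 2 <= 2 * (a * b) * (a * b - 1 - u * z).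
  have -> : (u - z) ^+ 2 = (a * b + 1 + u * z) * (a * b - 1 - u * z).
    by apply: (addrI ((1 + u * z) ^+ 2)); rewrite -e1; ring.
  by apply: ler_wpM2r; lra.
have e4 : a * b <= S ^+ 2 by rewrite expr2; apply: ler_pM; lra.
have -> : b = a + z / a * (u - z) + (a * b - 1 - u * z) / a.
  apply: (mulfI (lt0r_neq0 a0)).
  transitivity (a ^+ 2 + z * (u - z) + (a * b - 1 - u * z)).
    by rewrite a2; ring.
  by field; rewrite gt_eqF.
rewrite lerD2l ler_pdivrMr ?mulr_gt0 ?exprn_gt0// mulrAC ler_pdivlMr//.
have e5 : 0 <= a * b - 1 - u * z by lra.
apply: (@le_trans _ _ (2 * (a * b) * (a * b - 1 - u * z) * a)).
  by apply: ler_wpM2r => //; exact: ltW.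
rewrite [leRHS]mulrC -!mulrA ler_pM2l// mulrCA mulrA.
rewrite [leRHS](_ : _ = (S ^+ 2 * S) * (a * b - 1 - u * z)); last by ring.
rewrite [leLHS](_ : _ = (a * b * a) * (a * b - 1 - u * z)); last by ring.
apply: ler_wpM2r => //; apply: ler_pM => //; exact: ltW.
Qed.

Variable n : nat.
Implicit Types (x y z v : 'rV[R]_n) (f w : 'rV[R]_n -> R).

(** A right inverse [B] of [Q] recovers [v] from [v *m Q], so each coordinate of [v] is at most the
    norm of [v *m Q] times the absolute sum of a column of [B]. *)
Lemma row_free_sqnorm k (Q : 'M[R]_(n, k)) : row_free Q ->
  exists2 m : R, 0 < m & forall v, m * sqnorm v <= sqnorm (v *m Q).
Proof.
move=> /row_freeP[B QB].
pose c (j : 'I_n) := \sum_i `|B i j|.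
have c0 j : 0 <= c j by apply: sumr_ge0.
pose C := 1 + \sum_j c j ^+ 2.
have C0 : 0 < C by rewrite ltr_pwDl// sumr_ge0// => j _; rewrite sqr_ge0.
exists C^-1; first by rewrite invr_gt0.
move=> v; rewrite ler_pdivrMl//; set u := v *m Q; set U := sqnorm u.
have U0 : 0 <= U by exact: sqnorm_ge0.
have uU i : `|u 0 i| <= Num.sqrt U.
  rewrite -sqrtr_sqr ler_wsqrtr// /U /sqnorm (bigD1 i)//= lerDl.
  by apply: sumr_ge0 => j _; rewrite sqr_ge0.
have vj j : v 0 j ^+ 2 <= c j ^+ 2 * U.
  have -> : v = u *m B by rewrite /u -mulmxA QB mulmx1.
  rewrite -[U]sqr_sqrtr// -exprMn -[leLHS](real_normK (num_real _)).
  apply: lerXn2r; rewrite ?nnegrE ?mulr_ge0 ?sqrtr_ge0//.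
  rewrite mxE (le_trans (ler_norm_sum _ _ _))// mulr_suml.
  by apply: ler_sum => i _; rewrite normrM mulrC ler_wpM2l.
rewrite /C mulrDl mul1r mulr_suml.
by apply: le_trans (ler_sum _ (fun j _ => vj j)) _; rewrite lerDr.
Qed.

(* Slopes are added to Q as columns until no vector is orthogonal to all the
   differences; the rank of the kernel of Q decreases each time. *)
Lemma slopes_row_free f : convex_modulus 0 setT f ->
  (forall v alpha, v != 0 ->
     ~ forall x t, f (x + t *: v) = f x + alpha * t) ->
  exists (p : 'cV[R]_n) (k : nat) (Q : 'M[R]_(n, k)),
    [/\ row_free Q, slope f p & forall i, slope f (p + col i Q)].
Proof.
move=> cf nl; have [p hp] := subgradient_exists 0 cf.
have sp : slope f p by exists (- f 0) => y; have := hp y; rewrite subr0; lra.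
exists p.
have main m k (Q : 'M[R]_(n, k)) : (\rank (kermx Q) <= m)%N ->
    (forall i, slope f (p + col i Q)) ->
    exists (k : nat) (Q : 'M[R]_(n, k)),
      row_free Q /\ forall i, slope f (p + col i Q).
  elim: m k Q => [|m IHm] k Q rQ sQ.
    by exists k, Q; split=> //; rewrite -kermx_eq0 -mxrank_eq0 -leqn0.
  have [K0|K0] := eqVneq (kermx Q) 0.
    by exists k, Q; split=> //; rewrite -kermx_eq0 K0.
  pose v := nz_row (kermx Q).
  have v0 : v != 0 by rewrite /v nz_row_eq0.
  have vQ : v *m Q = 0 by apply/sub_kermxP; exact: nz_row_sub.
  (* Otherwise all slopes agree with [p] on [v], and [f] is affine along [v]. *)
  have [q [sq vq]] : exists q, slope f q /\ dot v q != dot v p.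
    apply: contrapT => nq; apply: (nl v (dot v p) v0).
    apply: slope_const_affine => // q sq; apply: contrapT => /eqP vqp.
    by apply: nq; exists q.
  apply: (IHm _ (row_mx Q (q - p))).
    rewrite -ltnS; apply: leq_trans rQ; apply: rank_ltmx.
    rewrite ltmxE; apply/andP; split.
      apply/sub_kermxP.
      have := mulmx_ker (row_mx Q (q - p)).
      by rewrite mul_mx_row -[RHS]row_mx0 => /eq_row_mx[].
    apply: contra vq => h.
    have /sub_kermxP : (v <= kermx (row_mx Q (q - p)))%MS.
      exact: submx_trans (nz_row_sub _) h.
    rewrite mul_mx_row -[RHS]row_mx0 => /eq_row_mx[_].
    by move/matrixP/(_ 0 0); rewrite -/(dot v _) dotDr dotNr mxE => /subr0_eq ->.
  move=> i; case: (split_ordP i) => j ->.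
    rewrite (_ : col _ _ = col j Q)//.
    by apply/colP => l; rewrite mxE row_mxEl mxE.
  rewrite (_ : col _ _ = q - p); first by rewrite addrC subrK.
  by apply/colP => l; rewrite mxE row_mxEr [j]ord1.
have [|k [Q [fQ sQ]]] := main n 0%N (0 : 'M[R]_(n, 0)) (rank_leq_row _).
  by case.
by exists k, Q.
Qed.

Lemma strongly_convex_minorant f : convex_modulus 0 setT f ->
  (forall v alpha, v != 0 ->
     ~ forall x t, f (x + t *: v) = f x + alpha * t) ->
  exists w, [/\ forall x, w x <= f x,
    exists p b, forall x, dot x p - b <= w x &
    forall z, exists2 m : R, 0 < m & convex_modulus m (ball z 1) w].
Proof.
move=> cf nl; have [p0 [k [Q [fQ [b0 hb0] sQ]]]] := slopes_row_free cf nl.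
have [b hb] := choice sQ.
pose u x i := (x *m Q) 0 i.
have uE x i : u x i = dot x (col i Q).
  by rewrite /u dotE mxE; apply: eq_bigr => j _; rewrite mxE.
(* One constant for all the minorants: [f - dot _ p0 + c] dominates 0 and every [u _ i]. *)
pose c := `|b0| + \sum_i `|b i|.
have sum0 : 0 <= \sum_i `|b i| by apply: sumr_ge0.
have F0 x : 0 <= f x - dot x p0 + c.
  by have := hb0 x; have := ler_norm b0; rewrite /c; lra.
have Fu i x : u x i <= f x - dot x p0 + c.
  have := hb i x; rewrite dotDr -uE.
  have : b i <= c.
    rewrite /c (bigD1 i)//= addrCA (le_trans (ler_norm _))// lerDl.
    by rewrite addr_ge0// sumr_ge0.
  lra.
(* A factor 1/2 for the smoothed maxima and [k.+1] for the average; [k.+1] instead of [k] makes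
   sense also when [k = 0], which happens for [n = 0]. *)
pose a : R := (2 * k.+1%:R)^-1.
have k0 : 0 < 2 * k.+1%:R :> R by rewrite mulr_gt0// ltr0n.
have a0 : 0 < a by rewrite invr_gt0.
have ak : a * (k%:R * 2) <= 1.
  by rewrite ler_pdivrMl// mulr1 mulrC ler_pM2l// ler_nat.
(* The last 1/2 compensates for the smoothing, since [(u + bump u) / 2] exceeds the maximum of [u]
   and 0 by at most 1/2. *)
pose w x := dot x p0 + a * \sum_i (u x i + bump (u x i)) - (c + 1 / 2).
pose p1 : 'cV[R]_n := p0 + a *: \sum_i col i Q.
have dot_sum x : dot x (\sum_i col i Q) = \sum_i u x i.
  rewrite /dot mulmx_sumr summxE; apply: eq_bigr => i _.
  by rewrite uE.
have wE x : w x = dot x p1 + a * \sum_i bump (u x i) - (c + 1 / 2).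
  by rewrite /w big_split /= mulrDr /p1 dotDr dotZr dot_sum addrA.
exists w; split.
- move=> x; set F := f x - dot x p0 + c.
  have : \sum_i (u x i + bump (u x i)) <= \sum_(i < k) (2 * F + 1).
    apply: ler_sum => i _; have := Fu i x; have := F0 x; rewrite -/F => h1 h2.
    have := bump_le (u x i).
    by case: (ger0P (u x i)) => h; lra.
  rewrite sumr_const card_ord -mulr_natr => /(ler_wpM2l (ltW a0)) h.
  have F0' : 0 <= F + 1 / 2 by have := F0 x; rewrite -/F; lra.
  have h2 := ler_wpM2r F0' ak.
  by rewrite /w; rewrite /F in h h2 *; lra.
- exists p1, (c + 1 / 2) => x; rewrite wE lerD2r lerDl mulr_ge0 ?(ltW a0)//.
  by apply: sumr_ge0 => i _; rewrite sqrtr_ge0.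
- move=> z; have [m0 m00 hm0] := row_free_sqnorm fQ.
  have bounded i : exists M : R, 0 <= M /\
      forall x, ball z 1 x -> `|dot x (col i Q)| <= M.
    by have [M M0 hM] := dot_bounded_ball z (col i Q); exists M.
  have [B hB] := choice bounded.
  (* [S] bounds every [bump (u x i)] on the ball, as the quadratic gain in [bump_tangent]
     requires. *)
  pose S : R := 1 + \sum_i B i.
  have B0 i : 0 <= B i by case: (hB i).
  have S1 : 1 <= S by rewrite lerDl sumr_ge0.
  have uS x i : ball z 1 x -> bump (u x i) <= S.
    move=> zx; apply: le_trans (bump_le _) _; rewrite lerD2l uE.
    apply: le_trans ((hB i).2 x zx) _; rewrite (bigD1 i)//= lerDl.
    by rewrite sumr_ge0.
  have S3 : 0 < 2 * S ^+ 3 by rewrite mulr_gt0// exprn_gt0//; lra.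
  exists (a * (m0 / (2 * S ^+ 3))); first by rewrite mulr_gt0// divr_gt0.
  apply: tangent_convex_modulus; first exact: convex_set_ball.
  move=> x zx.
  (* This is the gradient of [w] at [x]. The gain is a multiple of [|(y - x) Q|^2], hence of
     [|y - x|^2] because [Q] is row free. *)
  exists (p1 + a *: (\sum_i (u x i / bump (u x i)) *: col i Q)) => y zy.
  rewrite -/(dot _ _) !wE dotDr dotZr.
  have -> : dot (y - x) (\sum_i (u x i / bump (u x i)) *: col i Q) =
      \sum_i u x i / bump (u x i) * (u y i - u x i).
    rewrite /dot mulmx_sumr summxE; apply: eq_bigr => i _.
    by rewrite -/(dot _ _) dotZr dotDl dotNl !uE.
  have h1 : \sum_i (bump (u x i) + u x i / bump (u x i) * (u y i - u x i) +
      (u y i - u x i) ^+ 2 / (2 * S ^+ 3)) <= \sum_i bump (u y i).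
    by apply: ler_sum => i _; apply: bump_tangent; exact: uS.
  rewrite 2!big_split /= in h1.
  have h2 : \sum_i (u y i - u x i) ^+ 2 / (2 * S ^+ 3) =
      sqnorm ((y - x) *m Q) / (2 * S ^+ 3).
    rewrite /sqnorm mulr_suml; apply: eq_bigr => i _.
    by rewrite -[_ 0 i in RHS]/(u (y - x) i) !uE dotDl dotNl.
  have h3 : m0 / (2 * S ^+ 3) * sqnorm (y - x) <=
      sqnorm ((y - x) *m Q) / (2 * S ^+ 3).
    by rewrite mulrAC ler_pM2r ?invr_gt0.
  rewrite h2 in h1; have := ler_wpM2l (ltW a0) h1.
  have := ler_wpM2l (ltW a0) h3; rewrite dotDl dotNl; lra.
Qed.

End Minorant.

(** * Strong convexity of the regularised function *)

Section Regularisation.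
Variables (R : realType) (n : nat).
Implicit Types (f w : 'rV[R]_n -> R).

(* The tangent at u0 = f z - w z of the convex function u |-> eps / (1 + u)
   bounds the regularised function from below by (1 - l) f + l w + c, with
   equality at z, and l = eps / (1 + u0)^2 is bounded away from 0. *)
Lemma regularisation_modulus f w (eps : R) (z : 'rV[R]_n) :
  convex_modulus 0 setT f -> (forall x, w x <= f x) ->
  (exists p b, forall x, dot x p - b <= w x) ->
  (exists2 m : R, 0 < m & convex_modulus m (ball z 1) w) ->
  0 < eps -> eps <= 1 ->
  exists2 m : R, 0 < m &
    convex_modulus m (ball z 1) (fun x => f x + eps / (1 + (f x - w x))).
Proof.
move=> cf wf [p [b wp]] [m m0 cw] eps0 eps1.
have [M1 hM1] := convex_bounded_ball z cf.
have [M2 M20 hM2] := dot_bounded_ball z p.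
(* On the ball [f] is at most [M1], and the affine minorant bounds [w] from below by [- M2 - b]. *)
pose M := `|M1| + M2 + `|b|.
have uM x : ball z 1 x -> f x - w x <= M.
  move=> zx; have := hM1 x zx; have := hM2 x zx; have := wp x.
  rewrite ler_norml => h1 /andP[h2 _] h3; rewrite /M.
  by have := ler_norm M1; have := ler_norm b; lra.
have u0 x : 0 <= f x - w x by rewrite subr_ge0.
have M0 : 0 <= M by rewrite /M !addr_ge0.
pose k := eps / (1 + M) ^+ 2.
have k0 : 0 < k by rewrite divr_gt0// exprn_gt0//; lra.
exists (k * m); first exact: mulr_gt0.
move=> x y t zx zy t0 t1; set c := _ + _ *: y.
have zc : ball z 1 c by apply: convex_set_combine => //; exact: convex_set_ball.
pose v := 1 + (f c - w c); pose l := eps / v ^+ 2.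
have v1 : 1 <= v by rewrite lerDl.
have v0 : v != 0 by rewrite gt_eqF//; lra.
(* This makes [(1 - l) f + l w] a genuine convex combination; it uses [eps <= 1]. *)
have l1 : l <= 1.
  rewrite ler_pdivrMr ?exprn_gt0//; last by lra.
  by rewrite mul1r (le_trans eps1)// exprn_ege1.
have kl : k <= l.
  rewrite ler_pM2l// lef_pV2 ?posrE ?exprn_gt0//; try lra.
  by apply: lerXn2r; rewrite ?nnegrE ?lerD2l ?uM//; lra.
(* The difference of the two sides is [eps (1 + a - v)^2 / (v^2 (1 + a))]. *)
have tangent a : 0 <= a -> eps / v - l * (1 + a - v) <= eps / (1 + a).
  move=> a0; have a1 : 0 < 1 + a by lra.
  rewrite -subr_ge0 (_ : _ - _ = eps * (1 + a - v) ^+ 2 / (v ^+ 2 * (1 + a))).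
    rewrite divr_ge0// mulr_ge0 ?sqr_ge0 ?ltW//.
  by rewrite /l; field; rewrite v0 gt_eqF.
have t1' : 0 <= 1 - t by lra.
have hx := ler_wpM2l t1' (tangent _ (u0 x)).
have hy := ler_wpM2l t0 (tangent _ (u0 y)).
have l1' : 0 <= 1 - l by lra.
have hf := ler_wpM2l l1' (cf x y t I I t0 t1); rewrite !mul0r addr0 in hf.
have hw := ler_wpM2l (ltW (lt_le_trans k0 kl)) (cw x y t zx zy t0 t1).
rewrite -/c in hf hw *.
have hm : k * m * (t * (1 - t)) * sqnorm (x - y) <=
          l * (m * (t * (1 - t)) * sqnorm (x - y)).
  rewrite mulrA mulrA mulrA; apply: ler_wpM2r; first exact: sqnorm_ge0.
  rewrite -mulrA; apply: ler_wpM2r; first exact: mulr_ge0.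
  by rewrite ler_pM2r.
have -> : f c + eps / (1 + (f c - w c)) = f c + eps / v by [].
have lv : l * (1 + (f c - w c) - v) = 0 by rewrite subrr mulr0.
rewrite /v in lv hx hy; lra.
Qed.

End Regularisation.

(** * Local semiconcavity of C^2 functions *)

Section SecondOrder.
Variables (R : realType) (n : nat).
Implicit Types (x y z v p : 'rV[R]_n) (h : 'rV[R]_n -> R) (U : set 'rV[R]_n).

Lemma is_derive_line h x v (s : R) : derivable h (x + s *: v) v ->
  is_derive s (1 : R) (fun s => h (x + s *: v)) ('D_v h (x + s *: v)).
Proof.
move=> dh.
have E : (fun t : R => t^-1 *: (((fun s => h (x + s *: v)) \o shift s) (t *: 1) -
      h (x + s *: v))) =
    (fun t : R => t^-1 *: ((h \o shift (x + s *: v)) (t *: v) - h (x + s *: v))).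
  apply/funext => t /=; congr (_ *: (h _ - _)).
  by apply/rowP => i; rewrite !mxE; cbn; ring.
by split; rewrite /derivable /derive E.
Qed.

Lemma mean_value_line h x v (a b : R) :
  (forall s, Num.min a b <= s <= Num.max a b -> derivable h (x + s *: v) v) ->
  exists2 s, Num.min a b <= s <= Num.max a b &
    h (x + b *: v) - h (x + a *: v) = 'D_v h (x + s *: v) * (b - a).
Proof.
wlog ab : a b / a <= b => [W|] dh.
  have [ab|ba] := orP (le_total a b); first exact: W dh.
  have [|s sab hs] := W b a ba; first by rewrite minC maxC.
  exists s; first by rewrite minC maxC.
  by rewrite -[LHS]opprB hs -mulrN opprB.
rewrite (min_idPl ab) (max_idPr ab) in dh *.
have [s||s] := @MVT_segment R (fun s => h (x + s *: v))
  (fun s => 'D_v h (x + s *: v)) a b ab.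
- rewrite in_itv => /andP[sa sb]; apply: is_derive_line; apply: dh.
  by rewrite !ltW.
- apply: derivable_within_continuous => s; rewrite in_itv /= => sab.
  by case: (is_derive_line (dh s sab)).
- by rewrite in_itv /= => sab hs; exists s.
Qed.

(* h y - h x is telescoped along the broken line that changes the coordinates
   of x into those of y one at a time. *)
Lemma mean_value_coordinates h p (r : R) x y :
  (forall z i, ball p r z -> derivable h z (delta_mx 0 i)) ->
  ball p r x -> ball p r y ->
  exists xi : 'I_n -> 'rV[R]_n,
    (forall i, ball p r (xi i) /\
       forall j, `|xi i 0 j - x 0 j| <= `|y 0 j - x 0 j|) /\
    h y - h x = \sum_i 'D_(delta_mx 0 i) h (xi i) * (y 0 i - x 0 i).
Proof.
move=> dh px py; have r0 : 0 < r by case: px.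
have {}px := (ball_coordP p x r0).1 px.
have {}py := (ball_coordP p y r0).1 py.
(* The vertices of the broken line; [z i] is [c i] with its [i]-th coordinate set to 0, so that
   [c i] and [c i.+1] both lie on the line through [z i] directed by [e i]. *)
pose c (k : nat) : 'rV[R]_n := \row_i (if (i < k)%N then y 0 i else x 0 i).
pose z (i : 'I_n) : 'rV[R]_n := \row_j (if j == i then 0 else c i 0 j).
pose e (i : 'I_n) : 'rV[R]_n := delta_mx 0 i.
have cz (i : 'I_n) : c i = z i + x 0 i *: e i.
  apply/rowP => j; rewrite !mxE eqxx /=; case: eqP => [->|_].
    by rewrite ltnn mulr1 add0r.
  by rewrite mulr0 addr0.
have cSz (i : 'I_n) : c i.+1 = z i + y 0 i *: e i.
  apply/rowP => j; rewrite !mxE eqxx /= ltnS leq_eqVlt -val_eqE /=.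
  case: (ltngtP j i) => ij; rewrite ?mulr0 ?addr0 ?add0r ?mulr1//=.
  by congr (y 0 _); exact: val_inj.
have zb (i : 'I_n) s : Num.min (x 0 i) (y 0 i) <= s <= Num.max (x 0 i) (y 0 i) ->
    ball p r (z i + s *: e i) /\
    forall j, `|(z i + s *: e i) 0 j - x 0 j| <= `|y 0 j - x 0 j|.
  rewrite ge_min le_max => sxy; split.
    apply/(ball_coordP _ _ r0) => j; rewrite !mxE eqxx /=.
    have := px j; have := py j; case: eqP => [->|_].
      rewrite add0r mulr1 !ltr_norml => /andP[? ?] /andP[? ?].
      by apply/andP; case/andP: sxy => /orP[?|?] /orP[?|?]; split; lra.
    by rewrite mulr0 addr0; case: ifP.
  move=> j; rewrite !mxE eqxx /=; case: eqP => [->|_].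
    rewrite add0r mulr1.
    case/andP: sxy => /orP[?|?] /orP[?|?];
      case: (ger0P (y 0 i - x 0 i)) => ?; rewrite ler_norml; apply/andP; split; lra.
  by rewrite mulr0 addr0; case: ifP => // _; rewrite subrr normr0.
have mv (i : 'I_n) : exists q : 'rV[R]_n,
    (ball p r q /\ forall j, `|q 0 j - x 0 j| <= `|y 0 j - x 0 j|) /\
    h (c i.+1) - h (c i) = 'D_(e i) h q * (y 0 i - x 0 i).
  have [s /zb[b1 b2]|s sxy hs] := @mean_value_line h (z i) (e i) (x 0 i) (y 0 i).
    exact: dh.
  by exists (z i + s *: e i); split; [exact: zb|rewrite cz cSz].
have [xi hxi] := choice mv; exists xi; split=> [i|]; first by case: (hxi i).
have <- : c n = y by apply/rowP => i; rewrite mxE ltn_ord.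
have <- : c 0%N = x by apply/rowP => i; rewrite mxE.
have -> : h (c n) - h (c 0%N) = \sum_(0 <= k < n) (h (c k.+1) - h (c k)).
  by rewrite telescope_sumr.
rewrite big_mkord; apply: eq_bigr => i _; rewrite (hxi i).2.
by rewrite !mxE ltn_ord ltn0.
Qed.

(** Each coordinate is at most the Euclidean norm; the crude factor [n^2] is enough. *)
Lemma sum_norm_sqr v : (\sum_i `|v 0 i|) ^+ 2 <= n%:R ^+ 2 * sqnorm v.
Proof.
have v0 := sqnorm_ge0 v.
have h i : `|v 0 i| <= Num.sqrt (sqnorm v).
  rewrite -sqrtr_sqr ler_wsqrtr// /sqnorm (bigD1 i)//= lerDl.
  by apply: sumr_ge0 => j _; rewrite sqr_ge0.
rewrite -[in leRHS](sqr_sqrtr v0) -exprMn.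
apply: lerXn2r; rewrite ?nnegrE ?mulr_ge0 ?sqrtr_ge0 ?sumr_ge0//.
apply: le_trans (ler_sum _ (fun i _ => h i)) _.
by rewrite sumr_const card_ord mulr_natl.
Qed.

(** Near [p] the second partial derivatives are bounded by [K], so the first ones are Lipschitz and
    [h] exceeds its tangent by at most a multiple of [|y - z|^2]. *)
Lemma C2_semiconcave U h p : open U -> U p -> Ck_on 2 U h ->
  exists2 r : R, 0 < r & exists2 C : R, 0 < C &
    ball p r `<=` U /\ convex_modulus (- C) (ball p r) (fun x => - h x).
Proof.
move=> oU Up /= [_ Ch].
pose e (i : 'I_n) : 'rV[R]_n := delta_mx 0 i.
have d1 x i : U x -> derivable h x (e i) by move=> Ux; exact: (Ch i).1.
have d2 x i j : U x -> derivable ('D_(e i) h) x (e j).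
  by move=> Ux; exact: (((Ch i).2).2 j).1.
have c2 i j : {for p, continuous ('D_(e j) ('D_(e i) h))}.
  by case: (((Ch i).2).2 j) => _ [+ _]; exact.
pose D i j x := `|'D_(e j) ('D_(e i) h) x|.
pose K := 1 + \sum_i \sum_j D i j p.
have D0 i : 0 <= \sum_j D i j p by apply: sumr_ge0 => j _; exact: normr_ge0.
have K0 : 0 < K by rewrite ltr_pwDl// sumr_ge0// => i _; exact: D0.
have DK i j : D i j p < K.
  have h1 : D i j p <= \sum_j D i j p.
    by rewrite (bigD1 j)//= lerDl; apply: sumr_ge0 => k _; exact: normr_ge0.
  have h2 : \sum_j D i j p <= \sum_i \sum_j D i j p.
    rewrite [leRHS](bigD1 i) //= lerDl; apply: sumr_ge0 => k _; exact: D0.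
  rewrite /K; lra.
(* Indexing by pairs lets a single finite intersection of neighbourhoods handle all second partial
   derivatives. *)
have nD (ij : 'I_n * 'I_n) : nbhs p [set x | D ij.1 ij.2 x < K].
  have := @cvgr_lt _ _ _ (nbhs_filter p) _ _
    (@cvg_norm _ _ _ _ (nbhs_filter p) _ _ (c2 ij.1 ij.2)).
  by apply; exact: DK.
have nU : nbhs p U by exact: open_nbhs_nbhs.
have /nbhs_ballP[r /= r0 hr] :=
  @filterI _ _ (nbhs_filter p) _ _ nU (filter_forall (nbhs_filter p) nD).
have bU : ball p r `<=` U by move=> x /hr[].
have bD x i j : ball p r x -> D i j x <= K.
  by move=> /hr[_ /(_ (i, j)) /ltW].
(* The error is at most [K L^2], where [L] is the l^1 norm of [y - z]; adding 1 keeps the constant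
   positive for [n = 0]. *)
exists r => //; exists (K * n%:R ^+ 2 + 1).
  by rewrite ltr_wpDl// mulr_ge0 ?exprn_ge0 ?(ltW K0).
split=> //; apply: tangent_convex_modulus; first exact: convex_set_ball.
move=> z pz; exists (- \col_i 'D_(e i) h z) => y py.
rewrite -/(dot _ _) dotNr dotE.
have [xi [hxi ->]] : exists xi : 'I_n -> 'rV[R]_n,
    (forall i, ball p r (xi i) /\ forall j, `|xi i 0 j - z 0 j| <= `|y 0 j - z 0 j|) /\
    h y = h z + \sum_i 'D_(e i) h (xi i) * (y 0 i - z 0 i).
  have [|xi [h1 h2]] := @mean_value_coordinates h p r z y _ pz py.
    by move=> x i /bU; exact: d1.
  by exists xi; split=> //; rewrite -h2 addrC subrK.
pose L := \sum_i `|(y - z) 0 i|.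
have lip i : `|'D_(e i) h (xi i) - 'D_(e i) h z| <= K * L.
  have [|ze [h1 ->]] := @mean_value_coordinates ('D_(e i) h) p r z (xi i) _ pz (hxi i).1.
    by move=> x j /bU; exact: d2.
  rewrite (le_trans (ler_norm_sum _ _ _))// mulr_sumr; apply: ler_sum => j _.
  rewrite normrM ler_pM//; first exact: bD (h1 j).1.
  by rewrite !mxE; exact: (hxi i).2.
have : \sum_i ('D_(e i) h (xi i) - 'D_(e i) h z) * (y - z) 0 i <= K * L * L.
  rewrite [in leRHS]/L mulr_sumr; apply: ler_sum => i _.
  rewrite (le_trans (ler_norm _))// normrM ler_wpM2r//.
have -> : \sum_i ('D_(e i) h (xi i) - 'D_(e i) h z) * (y - z) 0 i =
    \sum_i 'D_(e i) h (xi i) * (y 0 i - z 0 i) -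
    \sum_i (y - z) 0 i * (\col_i 'D_(e i) h z) i 0.
  rewrite -sumrB; apply: eq_bigr => i _; rewrite !mxE; ring.
have := ler_wpM2l (ltW K0) (sum_norm_sqr (y - z)); rewrite -/L.
have := sqnorm_ge0 (y - z); lra.
Qed.

End SecondOrder.

(** * Quadratic functions, and [|x|^2] as a test function *)

Section QuadraticFunctions.
Variables (R : realType) (n : nat).
Implicit Types (x y z v p : 'rV[R]_n) (h g : 'rV[R]_n -> R).

(** This family is closed under partial derivatives, so its smoothness is an induction on the
    order. *)
Definition quadratic (a : R) (b : 'cV[R]_n) (c : R) x :=
  a * sqnorm x + dot x b + c.

Lemma sqnormD x v (s : R) :
  sqnorm (x + s *: v) = sqnorm x + 2 * s * dot x v^T + s ^+ 2 * sqnorm v.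
Proof.
rewrite dotE /sqnorm !mulr_sumr -!big_split /=.
by apply: eq_bigr => i _; rewrite !mxE; ring.
Qed.

Lemma quadratic_line a b c x v (s : R) :
  quadratic a b c (x + s *: v) =
  (a * sqnorm v) * s ^+ 2 + (2 * a * dot x v^T + dot v b) * s + quadratic a b c x.
Proof. by rewrite /quadratic sqnormD dotDl dotZl; ring. Qed.

Lemma is_derive_quadratic1 (A B C s : R) :
  is_derive s (1 : R) (fun s => A * s ^+ 2 + B * s + C) (2 * A * s + B).
Proof.
have -> : (fun s => A * s ^+ 2 + B * s + C) =
    A \*: (@id R) ^+ 2 + B \*: (@id R) + cst C by apply/funext.
apply: is_derive_eq.
by rewrite !scaler1 /= expr1; rewrite /GRing.scale /=; ring.
Qed.

Lemma is_derive_from_line h x v d :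
  is_derive (0 : R) (1 : R) (fun s => h (x + s *: v)) d -> is_derive x v h d.
Proof.
have E : (fun t : R => t^-1 *: (((fun s => h (x + s *: v)) \o shift 0) (t *: 1) -
      h (x + 0 *: v))) =
    (fun t : R => t^-1 *: ((h \o shift x) (t *: v) - h x)).
  apply/funext => t /=; rewrite scale0r !addr0; congr (_ *: (h _ - _)).
  by apply/rowP => i; rewrite !mxE; cbn; ring.
by case; rewrite /derivable /derive E => d1 d2; split.
Qed.

Lemma is_derive_quadratic a b c x v :
  is_derive x v (quadratic a b c) (2 * a * dot x v^T + dot v b).
Proof.
apply: is_derive_from_line.
under eq_fun do rewrite quadratic_line.
have := is_derive_quadratic1 (a * sqnorm v) (2 * a * dot x v^T + dot v b)
  (quadratic a b c x) 0.
by rewrite mulr0 add0r.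
Qed.

Lemma dot_continuous (b : 'cV[R]_n) : continuous (fun x => dot x b).
Proof.
under eq_fun do rewrite dotE.
apply: continuous_big => [|i _ x]; first exact: add_continuous.
apply: continuousM; last exact: cst_continuous.
exact: coord_continuous.
Qed.

Lemma sqnorm_continuous : continuous (@sqnorm R n).
Proof.
rewrite /sqnorm.
apply: continuous_big => [|i _ x]; first exact: add_continuous.
by apply: continuousM; exact: coord_continuous.
Qed.

Lemma quadratic_continuous a b c : continuous (quadratic a b c).
Proof.
move=> x; have -> : quadratic a b c = cst a * sqnorm (n:=n) + (fun x => dot x b) + cst c.
  by apply/funext.
apply: (@continuousD _ R^o); last exact: cst_continuous.
apply: (@continuousD _ R^o); last exact: dot_continuous.
by apply: continuousM; [exact: cst_continuous|exact: sqnorm_continuous].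
Qed.

Lemma quadratic_smooth a b c : smooth_on setT (quadratic a b c).
Proof.
move=> k; elim: k a b c => [|k IHk] a b c /=.
  by split=> // x _; exact: quadratic_continuous.
split=> [x _|i]; first exact: quadratic_continuous.
split=> [x _|]; first by case: (is_derive_quadratic a b c x (delta_mx 0 i)).
have -> : 'D_(delta_mx 0 i) (quadratic a b c) =
    quadratic 0 (2 * a *: (delta_mx 0 i)^T) (dot (delta_mx 0 i) b).
  apply/funext => x; have [_ ->] := is_derive_quadratic a b c x (delta_mx 0 i).
  by rewrite /quadratic mul0r add0r dotZr.
exact: IHk.
Qed.

Lemma sqnorm_strongly_convex_C2 :
  strongly_convex_C2_on [set: 'rV[R]_n] (quadratic 1 0 0).
Proof.
split=> [|x v t v0 _]; first exact: quadratic_smooth.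
have d0 : @dot R n v 0 = 0 by rewrite /dot mulmx0 mxE.
have -> : (fun s => quadratic 1 0 0 (x + s *: v)) =
    fun s => sqnorm v * s ^+ 2 + 2 * dot x v^T * s + quadratic 1 0 0 x.
  by apply/funext => s; rewrite quadratic_line d0; ring.
rewrite derive1nS derive1n1.
have -> : derive1 (fun s => sqnorm v * s ^+ 2 + 2 * dot x v^T * s +
    quadratic 1 0 0 x) = fun s => 0 * s ^+ 2 + 2 * sqnorm v * s + 2 * dot x v^T.
  apply/funext => s; rewrite derive1E.
  have [_ ->] := is_derive_quadratic1 (sqnorm v) (2 * dot x v^T)
    (quadratic 1 0 0 x) s.
  ring.
rewrite derive1E.
have [_ ->] := is_derive_quadratic1 0 (2 * sqnorm v) (2 * dot x v^T) t.
by rewrite mulr0 mul0r add0r mulr_gt0// sqnorm_gt0.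
Qed.

(** Equality holds, coordinate by coordinate. *)
Lemma sqnorm_modulus D : convex_modulus 1 D (@sqnorm R n).
Proof.
move=> x y t _ _ _ _.
rewrite /sqnorm !mulr_sumr -!big_split /=; apply: ler_sum => i _.
by rewrite !mxE; nra.
Qed.

(** Strong convexity is tested on [|x|^2]: [g] is locally the convex function [g - d |x|^2] plus
    [d |x|^2], which has modulus [d]. *)
Lemma strongly_convex_local_modulus g : strongly_convex g ->
  forall p, exists2 m : R, 0 < m &
    exists2 r : R, 0 < r & convex_modulus m (ball p r) g.
Proof.
move=> sg p; have [d d0 [V [/nbhs_ballP[r /= r0 rV] _ _ cV]]] := sg p setT _ openT I
  (@quadratic_smooth 1 0 0) sqnorm_strongly_convex_C2.
exists d => //; exists r => //; apply: (sub_convex_modulus rV).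
move/convex_function_modulus in cV.
have := convex_modulusD cV (convex_modulusZ (ltW d0) (@sqnorm_modulus V)).
rewrite add0r mulr1; congr convex_modulus; apply/funext => x.
by rewrite /quadratic /dot mulmx0 mxE; ring.
Qed.

End QuadraticFunctions.

(** * From local moduli to strict convexity on segments *)

Section LocalToGlobal.
Variable R : realType.

Definition convex_modulus1 (m : R) (a b : R) (h : R -> R) :=
  forall s1 s2 l, a < s1 < b -> a < s2 < b -> 0 <= l -> l <= 1 ->
    h ((1 - l) * s1 + l * s2) + m * (l * (1 - l)) * (s1 - s2) ^+ 2 <=
    (1 - l) * h s1 + l * h s2.

(** The point [t + e l q], with [e = 1] or [e = -1], lies between [t] and [t + e q], which bounds
    [h] there from above; and [t] lies between it and [t - e q], which bounds [h] there from below.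
    So [h] varies by at most [l B]. *)
Lemma convex_modulus1_continuous (m r t : R) (h : R -> R) : 0 <= m -> 0 < r ->
  convex_modulus1 m (t - r) (t + r) h -> {for t, continuous h}.
Proof.
move=> m0 r0 ch; pose q := r / 2.
have q0 : 0 < q by rewrite divr_gt0.
have qr : q < r by rewrite /q; lra.
pose B := 1 + `|h (t + q) - h t| + `|h (t - q) - h t|.
have B0 : 0 < B by rewrite /B -addrA ltr_pwDl// addr_ge0.
have hcv s1 s2 l : t - r < s1 < t + r -> t - r < s2 < t + r -> 0 <= l -> l <= 1 ->
    h ((1 - l) * s1 + l * s2) <= (1 - l) * h s1 + l * h s2.
  move=> a1 a2 l0 l1; apply: le_trans (ch _ _ _ a1 a2 l0 l1).
  rewrite lerDl mulr_ge0 ?sqr_ge0//.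
  by rewrite mulr_ge0// mulr_ge0// subr_ge0.
have tr : t - r < t < t + r by apply/andP; split; lra.
have two (e l : R) : (e = 1) \/ (e = -1) -> 0 <= l -> l <= 1 ->
    `|h (t + e * (l * q)) - h t| <= l * B.
  move=> e1 l0 l1.
  have eq1 : t - r < t + e * q < t + r by case: e1 => ->; apply/andP; split; lra.
  have eq2 : t - r < t - e * q < t + r by case: e1 => ->; apply/andP; split; lra.
  have h1 := hcv t (t + e * q) l tr eq1 l0 l1.
  have hB : forall e', (e' = 1) \/ (e' = -1) -> `|h (t + e' * q) - h t| <= B.
    move=> e' [->|->]; rewrite ?mul1r ?mulN1r /B.
      by have := normr_ge0 (h (t - q) - h t); lra.
    by have := normr_ge0 (h (t + q) - h t); lra.
  have hB1 := hB e e1.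
  have hB2 := hB (- e) ltac:(case: e1 => ->; [right|left; rewrite opprK]; by []).
  have l1p : 0 < 1 + l by lra.
  have E1 : (1 - l) * t + l * (t + e * q) = t + e * (l * q) by ring.
  rewrite E1 in h1.
  have lq : t - r < t + e * (l * q) < t + r.
    have : l * q <= q by rewrite ler_piMl// ltW.
    have : 0 <= l * q by rewrite mulr_ge0// ltW.
    by case: e1 => -> *; apply/andP; split; lra.
  have h2 := hcv (t + e * (l * q)) (t - e * q) (l / (1 + l)) lq eq2.
  have E2 : (1 - l / (1 + l)) * (t + e * (l * q)) + l / (1 + l) * (t - e * q) = t.
    by field; rewrite gt_eqF.
  rewrite E2 in h2.
  have d0 : 0 <= l / (1 + l) by rewrite divr_ge0// ltW.
  have d1 : l / (1 + l) <= 1 by rewrite ler_pdivrMr//; lra.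
  have {}h2 := ler_wpM2l (ltW l1p) (h2 d0 d1).
  have E3 : (1 + l) * ((1 - l / (1 + l)) * h (t + e * (l * q)) +
      l / (1 + l) * h (t - e * q)) = h (t + e * (l * q)) + l * h (t - e * q).
    by field; rewrite gt_eqF.
  rewrite E3 in h2; rewrite mulNr in hB2.
  move: hB1 hB2; rewrite !ler_norml => /andP[b1 b2] /andP[b3 b4].
  have c1 := ler_wpM2l l0 b2; have c2 := ler_wpM2l l0 b4.
  by apply/andP; split; lra.
apply/cvgrPdist_le => /= e e0.
near=> s.
have sq : `|s - t| <= q.
  by rewrite distrC; near: s; apply: cvgr_dist_le => //; exact: cvg_id.
have se : `|s - t| <= e * q / B.
  rewrite distrC; near: s; apply: cvgr_dist_le; first exact: cvg_id.
  by rewrite divr_gt0// mulr_gt0.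
rewrite distrC; pose l := `|s - t| / q.
have l0 : 0 <= l by rewrite divr_ge0// ltW.
have l1 : l <= 1 by rewrite ler_pdivrMr// mul1r.
have lB : l * B <= e.
  by rewrite /l mulrAC ler_pdivrMr// -ler_pdivlMr.
apply: le_trans lB.
have lq : l * q = `|s - t| by rewrite /l divfK// gt_eqF.
have := two (if 0 <= s - t then 1 else -1) l _ l0 l1.
rewrite lq; case: (ger0P (s - t)) => st.
  by rewrite mul1r [t + _]addrC subrK; apply; left.
by rewrite mulN1r opprK [t + _]addrC subrK; apply; right.
Unshelve. all: by end_near. Qed.

(* The maximum over [0, 1] cannot be attained at an interior point, where h is
   strictly below the mean of two nearby values. *)
Lemma local_modulus_lt0 (h : R -> R) :
  (forall t, exists2 m : R, 0 < m & exists2 r : R, 0 < r &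
     convex_modulus1 m (t - r) (t + r) h) ->
  h 0 = 0 -> h 1 = 0 -> forall t, 0 < t -> t < 1 -> h t < 0.
Proof.
move=> lh h0 h1 t t0 t1.
have ch : {within `[0, 1], continuous h}.
  apply: continuous_subspaceT => s; have [m m0 [r r0 cr]] := lh s.
  exact: convex_modulus1_continuous (ltW m0) r0 cr.
have [c c01 cmax] := EVT_max ler01 ch.
move: c01; rewrite in_itv /= => /andP[c0 c1].
have nomax s : 0 < s -> s < 1 -> ~ (forall u, 0 <= u <= 1 -> h u <= h s).
  move=> s0 s1 smax; have [m m0 [r r0 cr]] := lh s.
  pose d := Num.min (Num.min s (1 - s)) (r / 2).
  have d0 : 0 < d by rewrite !lt_min s0 subr_gt0 s1 divr_gt0.
  have ds : d <= s by rewrite /d !ge_min lexx.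
  have ds1 : d <= 1 - s by rewrite /d !ge_min lexx orbT.
  have dr : d <= r / 2 by rewrite /d !ge_min lexx orbT.
  have := cr (s - d) (s + d) (1 / 2).
  have -> : (1 - 1 / 2) * (s - d) + 1 / 2 * (s + d) = s by field.
  have -> : s - d - (s + d) = - (2 * d) by ring.
  move=> H; have {}H := H ltac:(apply/andP; split; lra) ltac:(apply/andP; split; lra)
    ltac:(lra) ltac:(lra).
  have b1 := smax (s - d) ltac:(apply/andP; split; lra).
  have b2 := smax (s + d) ltac:(apply/andP; split; lra).
  have : 0 < m * (1 / 2 * (1 - 1 / 2)) * (- (2 * d)) ^+ 2.
    by rewrite sqrrN mulr_gt0// ?exprn_gt0 ?mulr_gt0//; lra.
  lra.
have hc0 : 0 <= h c by rewrite -h0; apply: cmax; rewrite in_itv /= lexx ler01.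
case: (ltrP (h t) 0) => // ht; exfalso.
have max01 s : h c <= h s -> forall u, 0 <= u <= 1 -> h u <= h s.
  by move=> cs u u01; apply: le_trans cs; apply: cmax; rewrite in_itv.
(* A positive maximum is attained away from the endpoints, where [h] vanishes. Otherwise
   [h c <= 0 <= h t], and [t] itself is an interior maximum. *)
have [hcp|hcn] := ltrP 0 (h c).
  have c0' : 0 < c.
    by rewrite lt_neqAle c0 andbT; apply/eqP => cc; rewrite -cc h0 ltxx in hcp.
  have c1' : c < 1.
    by rewrite lt_neqAle c1 andbT; apply/eqP => cc; rewrite cc h1 ltxx in hcp.
  exact: (nomax c c0' c1' (max01 c (lexx _))).
by apply: (nomax t t0 t1); apply: max01; exact: le_trans hcn ht.
Qed.

(** Subtracting the chord from [g] along the segment gives a function [h] that vanishes at 0 and 1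
    and inherits the local moduli. *)
Lemma strongly_convex_strictly_convex (n : nat) (g : 'rV[R]_n -> R) :
  strongly_convex g -> strictly_convex g.
Proof.
move=> sg x y t xy t0 t1; pose c (s : R) := (1 - s) *: x + s *: y.
pose h s := g (c s) - ((1 - s) * g x + s * g y).
suff : h t < 0 by rewrite subr_lt0.
apply: local_modulus_lt0 => //; last 2 first.
- by rewrite /h /c subr0 scale1r scale0r addr0 mul1r mul0r addr0 subrr.
- by rewrite /h /c subrr scale1r scale0r add0r mul1r mul0r add0r subrr.
move=> s; have [m m0 [r r0 cm]] := strongly_convex_local_modulus sg (c s).
exists (m * sqnorm (x - y)).
  by rewrite mulr_gt0// sqnorm_gt0// subr_eq0.
(* [S] bounds the speed of [c] in the sup norm, so parameters within [r / S] of [s] stay in the ball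
   of radius [r]. *)
pose S := 1 + \sum_i `|x 0 i - y 0 i|.
have S0 : 0 < S by rewrite ltr_pwDl// sumr_ge0.
exists (r / S); first by rewrite divr_gt0.
have cb u : s - r / S < u < s + r / S -> ball (c s) r (c u).
  move=> su; apply/(ball_coordP _ _ r0) => i.
  have -> : c s 0 i - c u 0 i = (u - s) * (x 0 i - y 0 i).
    by rewrite /c !mxE; ring.
  have us : `|u - s| < r / S.
    by rewrite ltr_norml; case/andP: su => *; apply/andP; split; lra.
  rewrite normrM; rewrite ltr_pdivlMr// in us; apply: le_lt_trans us.
  rewrite ler_wpM2l// /S (bigD1 i)//= addrCA lerDl addr_ge0// sumr_ge0//.
move=> s1 s2 l hs1 hs2 l0 l1.
have := cm _ _ _ (cb _ hs1) (cb _ hs2) l0 l1.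
have -> : (1 - l) *: c s1 + l *: c s2 = c ((1 - l) * s1 + l * s2).
  by apply/rowP => i; rewrite /c !mxE; ring.
have -> : c s1 - c s2 = (s2 - s1) *: (x - y).
  by apply/rowP => i; rewrite /c !mxE; ring.
rewrite sqnormZ /h; lra.
Qed.

End LocalToGlobal.

(** * Approximation of functions affine along no line *)

Section Approximation.
Variables (R : realType) (n : nat).
Implicit Types (x y z v : 'rV[R]_n) (f g : 'rV[R]_n -> R).

(** If [g] has modulus [m] and [- phi] has modulus [- C] near [p], then [delta = m / C] makes the
    moduli cancel in [g - delta phi]. *)
Lemma local_modulus_strongly_convex g :
  (forall z, exists2 m : R, 0 < m & convex_modulus m (ball z 1) g) ->
  strongly_convex g.
Proof.
move=> cg p U phi oU Up _ [C2 _].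
have [m m0 cm] := cg p.
have [r r0 [C C0 [rU cphi]]] := C2_semiconcave oU Up C2.
pose d := m / C; have d0 : 0 < d by rewrite divr_gt0.
exists d => //; pose q := Num.min r 1.
have q0 : 0 < q by rewrite lt_min r0 ltr01.
have qr : ball p q `<=` ball p r by apply: le_ball; rewrite ge_min lexx.
have q1 : ball p q `<=` ball p 1 by apply: le_ball; rewrite ge_min lexx orbT.
exists (ball p q); split.
- exact: nbhsx_ballx.
- exact: subset_trans qr rU.
- exact: convex_set_ball.
apply/convex_function_modulus.
have := convex_modulusD (sub_convex_modulus q1 cm)
  (convex_modulusZ (ltW d0) (sub_convex_modulus qr cphi)).
have -> : m + d * - C = 0 by rewrite mulrN divfK ?subrr// gt_eqF.
by congr convex_modulus; apply/funext => x; rewrite mulrN.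
Qed.

Lemma no_affine_line_approximable f : convex_modulus 0 setT f ->
  (forall v alpha, v != 0 ->
     ~ forall x t, f (x + t *: v) = f x + alpha * t) ->
  uniformly_approximable (@strongly_convex R n) f.
Proof.
(* The regularisation needs a parameter that is at most 1. *)
move=> cf nl eps eps0; pose e := Num.min eps 1.
have e0 : 0 < e by rewrite lt_min eps0 ltr01.
have e1 : e <= 1 by rewrite ge_min lexx orbT.
have ee : e <= eps by rewrite ge_min lexx.
have [w [wf wl wm]] := strongly_convex_minorant cf nl.
exists (fun x => f x + e / (1 + (f x - w x))).
  apply: local_modulus_strongly_convex => z.
  exact: regularisation_modulus (wm z) e0 e1.
move=> x; have u0 : 0 <= f x - w x by rewrite subr_ge0.
have u1 : 0 < 1 + (f x - w x) by lra.
rewrite opprD addrA subrr add0r normrN ger0_norm; last first.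
  by rewrite divr_ge0// ltW.
rewrite ler_pdivrMr//; apply: le_trans ee _.
by rewrite ler_peMr ?(ltW eps0)//; lra.
Qed.

End Approximation.

(** * Affine lines and factorisation through a projection *)

Section Factorisation.
Variables (R : realType).

(** Each [x] is moved along [v] to the hyperplane where the [j]-th coordinate vanishes, with [v 0 j]
    nonzero; [P] reads off the other coordinates and [l] records the change of [f]. *)
Lemma affine_line_factor (n : nat) (f : 'rV[R]_n -> R) (v : 'rV[R]_n) (alpha : R) :
  convex_modulus 0 setT f -> v != 0 ->
  (forall x t, f (x + t *: v) = f x + alpha * t) ->
  exists (k : nat) (P : {linear 'rV[R]_n -> 'rV[R]_k})
         (c : 'rV[R]_k -> R) (l : {scalar 'rV[R]_n}),
    [/\ (k < n)%N,
        (forall y : 'rV[R]_k, exists x : 'rV[R]_n, P x = y),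
        convex_function (E := 'rV[R]_k) setT c &
        forall x : 'rV[R]_n, f x = c (P x) + l x].
Proof.
case: n => [|n] in f v *.
  by move=> _ /eqP[]; apply/rowP; case.
move=> cf v0 fv.
have [j vj] : exists j, v 0 j != 0 by apply/rV0Pn.
(* [emb] inserts a zero at position [j], and [red] is the projection along [v] onto its image. *)
pose emb : 'M[R]_(n, n.+1) := \matrix_(i, i') (lift j i == i')%:R.
pose red (x : 'rV[R]_n.+1) := x - (x 0 j / v 0 j) *: v.
pose Pf (x : 'rV[R]_n.+1) : 'rV[R]_n := \row_i red x 0 (lift j i).
have PfL : linear Pf.
  by move=> a x y; apply/rowP => i; rewrite !mxE; ring.
pose lf (x : 'rV[R]_n.+1) : R := alpha * (x 0 j / v 0 j).
have lfL : scalar lf.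
  by move=> a x y; rewrite /lf !mxE; ring.
pose PH := GRing.isLinear.Build R 'rV[R]_n.+1 'rV[R]_n *:%R Pf PfL.
pose lH := GRing.isLinear.Build R 'rV[R]_n.+1 R *%R lf lfL.
pose P : {linear 'rV[R]_n.+1 -> 'rV[R]_n} := HB.pack Pf PH.
pose l : {scalar 'rV[R]_n.+1} := HB.pack lf lH.
have emb_lift y i : (y *m emb) 0 (lift j i) = y 0 i.
  rewrite mxE (bigD1 i)//= mxE eqxx mulr1 big1 ?addr0// => k ki.
  by rewrite mxE (inj_eq lift_inj) (negbTE ki) mulr0.
have emb_j y : (y *m emb) 0 j = 0.
  by rewrite mxE big1// => k _; rewrite mxE eq_sym (negbTE (neq_lift _ _)) mulr0.
exists n, P, (fun y => f (y *m emb)), l; split => //.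
- move=> y; exists (y *m emb); apply/rowP => i.
  by rewrite mxE /red emb_j mul0r scale0r subr0 emb_lift.
- apply/convex_function_modulus => x y t _ _ t0 t1.
  rewrite mulmxDl -!scalemxAl !mul0r addr0.
  by have := cf (x *m emb) (y *m emb) t I I t0 t1; rewrite !mul0r addr0.
- move=> x; have -> : P x *m emb = red x.
    apply/rowP => i; case: (unliftP j i) => [k|] ->.
      by rewrite emb_lift mxE.
    by rewrite emb_j !mxE divfK// subrr.
  rewrite [l x]/(alpha * (x 0 j / v 0 j)) -fv.
  by rewrite /red subrK.
Qed.

(** Since [k < n], some nonzero [v] is in the kernel of [P], and [f] is affine along it. A strictly
    convex [g] close to [f] would give a bounded strictly convex [h] on the real line. *)
Lemma factor_not_approximable (n k : nat) (f : 'rV[R]_n -> R)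
    (P : {linear 'rV[R]_n -> 'rV[R]_k}) (c : 'rV[R]_k -> R)
    (l : {scalar 'rV[R]_n}) : (k < n)%N ->
  (forall x, f x = c (P x) + l x) ->
  ~ uniformly_approximable (@strictly_convex R n) f.
Proof.
move=> kn fE ap.
have [v v0 Pv] : exists2 v : 'rV[R]_n, v != 0 & P v = 0.
  exists (nz_row (kermx (lin1_mx P))).
    rewrite nz_row_eq0 -mxrank_eq0 mxrank_ker subn_eq0 -ltnNge.
    exact: leq_ltn_trans (rank_leq_col _) kn.
  by rewrite -mul_rV_lin1; apply/sub_kermxP; exact: nz_row_sub.
have fv t : f (t *: v) = c 0 + t * l v.
  by rewrite fE !linearZ /= Pv scaler0.
clear Pv fE.
have [g sg fg] := ap 1 ltr01.
pose h t := g (t *: v) - (c 0 + t * l v).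
have hb t : `|h t| <= 1 by rewrite /h -fv distrC.
have hs s t u : s != t -> 0 < u -> u < 1 ->
    h ((1 - u) * s + u * t) < (1 - u) * h s + u * h t.
  move=> st u0 u1; have := sg (s *: v) (t *: v) u.
  rewrite -subr_eq0 -scalerBl scaler_eq0 subr_eq0 (negbTE st) (negbTE v0).
  by rewrite !scalerA -scalerDl /h => /(_ isT u0 u1); lra.
(* If [h e] exceeded [h 0] by [d > 0], convexity would make [h (M e)] exceed [h 0] by more than
   [M d > 2], although [|h| <= 1]. *)
have grow (e : R) : e != 0 -> h e <= h 0.
  move=> e0; rewrite leNgt; apply/negP => h0.
  pose d := h e - h 0; have d0 : 0 < d by rewrite subr_gt0.
  have [N hN] : exists N : nat, 2 / d < N%:R.
    by exists (Num.bound (2 / d)); apply: archi_boundP; rewrite divr_ge0// ltW.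
  have N0 : (0 : R) < N.+2%:R by rewrite ltr0n.
  (* [N.+2] is at least 2, so its inverse is a weight strictly between 0 and 1. *)
  have := hs 0 (N.+2%:R * e) (N.+2%:R^-1).
  rewrite eq_sym mulf_eq0 pnatr_eq0 (negbTE e0) /= invr_gt0 N0 invf_lt1// ltr1n.
  move=> /(_ isT isT isT); rewrite mulr0 add0r mulKf ?gt_eqF// => hlt.
  set M : R := N.+2%:R in N0 hlt.
  have NM : N%:R <= M by rewrite ler_nat ltnW.
  have hM : M * h e < M * ((1 - M^-1) * h 0 + M^-1 * h (M * e)).
    by rewrite ltr_pM2l.
  have E : M * ((1 - M^-1) * h 0 + M^-1 * h (M * e)) = M * h 0 - h 0 + h (M * e).
    by field; rewrite gt_eqF.
  rewrite E in hM.
  have Md : 2 < M * d by rewrite -ltr_pdivrMr//; exact: lt_le_trans hN NM.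
  have := hb 0; have := hb (M * e); rewrite !ler_norml => /andP[a1 a2] /andP[a3 a4].
  by rewrite /d in Md; lra.
(* Strict convexity puts [h 0] below the mean of [h 1] and [h (-1)], both of which are at most
   [h 0]. *)
have := hs 1 (-1) (1 / 2).
have -> : (1 - 1 / 2) * 1 + 1 / 2 * -1 = 0 :> R by field.
have ne : (1 : R) != -1 by apply/eqP => h1; have := @ltr01 R; lra.
move=> H; have {}H := H ne ltac:(lra) ltac:(lra).
have g1 := grow 1 (oner_neq0 _).
have g2 := grow (-1) ltac:(by rewrite oppr_eq0 oner_eq0).
lra.
Qed.

End Factorisation.

(** * The cycle of implications, by contraposition in its first two steps *)

Theorem proposition1 (R : realType) (n : nat) (f : 'rV[R]_n -> R)
    (hf : convex_function (E := 'rV[R]_n) setT f) :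
  [<-> ~ uniformly_approximable (@strictly_convex R n) f;
       ~ uniformly_approximable (@strongly_convex R n) f;
       exists (k : nat) (P : {linear 'rV[R]_n -> 'rV[R]_k})
              (c : 'rV[R]_k -> R) (l : {scalar 'rV[R]_n}),
         [/\ (k < n)%N,
             (forall y : 'rV[R]_k, exists x : 'rV[R]_n, P x = y),
             convex_function (E := 'rV[R]_k) setT c &
             forall x : 'rV[R]_n, f x = c (P x) + l x]].
Proof.
have cf : convex_modulus 0 setT f by apply/convex_function_modulus.
tfae.
- move=> nstrict strong; apply: nstrict => eps eps0.
  have [g sg fg] := strong eps eps0; exists g => //.
  exact: strongly_convex_strictly_convex.
- move=> nstrong; apply: contrapT => nfactor; apply: nstrong.
  apply: no_affine_line_approximable => // v alpha v0 fv; apply: nfactor.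
  exact: affine_line_factor cf v0 fv.
- by move=> [k [P [c [l [kn _ _ fE]]]]]; exact: factor_not_approximable kn fE.
Qed.
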